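(* Let $\Psi$ be a non-singular complex-linear map from $\mathbb{C}^n$ to itself such that both $\Psi$ and $\Psi^{-1}$ have the special Lagrangian linear non-squeezing property. Then $\Psi$ preserves $\Omega$ up to a phase, that is, $\Psi^*\Omega = e^{i\theta}\Omega$ for some real $\theta$.
   Context: Identify $\mathbb{C}^n = \mathbb{R}^{2n}$ with coordinates $z^k = x^k+iy^k$ and the standard Euclidean metric. $\Omega = dz^1\wedge\cdots\wedge dz^n$ is regarded as a complex-valued $n$-form on $\mathbb{R}^{2n}$. $B(r)$ is the closed ball of radius $r>0$ centered at the origin in $\mathbb{R}^{2n}$. For $L = \mathbb{R}^n\subset\mathbb{C}^n$ (the points with all $y^k=0$) and $R>0$, $Z_L(R) = \{x\in\mathbb{R}^{2n} : |\mathrm{proj}_L(x)|^2\leq R^2\}$, with $\mathrm{proj}_L$ the orthogonal projection onto $L$. A subset $B\subseteq\mathbb{R}^{2n}$ is a linear special Lagrangian ball of radius $r$ if $B = A(B(r))$ for some real-linear map $A$ of $\mathbb{R}^{2n}$ with $A^*\Omega=\Omega$. A subset $Z\subseteq\mathbb{R}^{2n}$ is a linear special Lagrangian cylinder of radius $R$ if $Z = A(Z_L(R))$ for some real-linear map $A$ with $A^*\Omega=\Omega$, where $L=\mathbb{R}^n$. A linear map $\Psi\colon\mathbb{R}^{2n}\to\mathbb{R}^{2n}$ has the special Lagrangian linear non-squeezing property if, for every linear special Lagrangian ball $B$ of radius $r$ and every linear special Lagrangian cylinder $Z$ of radius $R$, the condition $\Psi(B)\subseteq Z$ implies $r\leq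 R$. *)

(* Defs.v *)
From HB Require Import structures.
From mathcomp Require Import all_boot all_order all_algebra.
From mathcomp Require Import classical_sets reals trigo.
From mathcomp Require Export complex.
Set Implicit Arguments.
Unset Strict Implicit.
Unset Printing Implicit Defensive.
Import Order.TTheory GRing.Theory Num.Theory.
Local Open Scope ring_scope.
Local Open Scope complex_scope.
Local Open Scope classical_set_scope.

(* R^{2n} is the real vector space underlying 'cV[R[i]]_n, with real
   coordinates xcoord k, ycoord k (k < n). The library makes 'cV[R[i]]_n a
   module over R[i] only, so linearity over R is spelled out in real_linear. *)

Section SpecialLagrangian.
Variables (R : realType) (n : nat).
Local Notation Cn := 'cV[R[i]]_n.
Implicit Types (u v : Cn) (f A : Cn -> Cn).

Definition xcoord (k : 'I_n) v : R := complex.Re (v k 0).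
Definition ycoord (k : 'I_n) v : R := complex.Im (v k 0).

Definition edot u v : R :=
  \sum_(k < n) (xcoord k u * xcoord k v + ycoord k u * ycoord k v).
Definition enorm v : R := Num.sqrt (edot v v).

Definition real_linear f : Prop :=
  forall (a : R) u v, f (a%:C *: u + v) = a%:C *: f u + f v.

Definition dz (k : 'I_n) v : R[i] := xcoord k v +i* ycoord k v.

(* alpha_0 /\ ... /\ alpha_(n-1) evaluated at (w_0, ..., w_(n-1)), in the
   normalization without the factor 1/n! *)
Definition wedge (alpha : 'I_n -> Cn -> R[i]) (w : 'I_n -> Cn) : R[i] :=
  \det (\matrix_(j, k) alpha j (w k)).

Definition Omega : ('I_n -> Cn) -> R[i] := wedge dz.

Definition pullback A (F : ('I_n -> Cn) -> R[i]) (w : 'I_n -> Cn) : R[i] :=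
  F (fun k => A (w k)).

Definition ball0 (r : R) : set Cn := [set v | enorm v <= r].

Definition Lplane : set Cn := [set v | forall k, ycoord k v = 0].

Definition projL v : Cn := \col_k (xcoord k v)%:C.

Lemma projL_in v : Lplane (projL v).
Proof. by move=> k; rewrite /ycoord mxE. Qed.

Lemma projL_orthogonal v u : Lplane u -> edot (v - projL v) u = 0.
Proof.
move=> Lu; apply: big1 => k _.
by rewrite Lu mulr0 addr0 /xcoord !mxE raddfB /= subrr mul0r.
Qed.

Definition cylL (rho : R) : set Cn := [set v | enorm (projL v) ^+ 2 <= rho ^+ 2].

Definition preserves_Omega A : Prop := pullback A Omega =1 Omega.

Definition sl_ball (r : R) (B : set Cn) : Prop :=
  exists A, [/\ real_linear A, preserves_Omega A & B = A @` ball0 r].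

Definition sl_cylinder (rho : R) (Z : set Cn) : Prop :=
  exists A, [/\ real_linear A, preserves_Omega A & Z = A @` cylL rho].

Definition sl_nonsqueezing f : Prop :=
  forall (r rho : R) (B Z : set Cn), 0 < r -> 0 < rho ->
    sl_ball r B -> sl_cylinder rho Z -> f @` B `<=` Z -> r <= rho.

End SpecialLagrangian.

Arguments Omega {R n}.

(* Main.v *)
Require Import Defs.
From mathcomp Require Import all_boot all_order all_algebra.
From mathcomp Require Import reals trigo.
From mathcomp Require Import classical_sets ring.
Import Order.TTheory GRing.Theory Num.Theory.
Local Open Scope ring_scope.
Local Open Scope complex_scope.

(** A complex-linear map multiplies [Omega] by its complex determinant, so the
    claim is that this determinant has modulus 1.

    Let [f] be non-squeezing with inverse [g].  Choose a complex [mu] with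
    [mu ^+ n * det g = 1].  Then [mu *: g] preserves [Omega], so the image of
    the unit ball under it is a special Lagrangian ball of radius 1.  But [f]
    sends that ball to [mu] times the unit ball, that is, to the round ball of
    radius [`|mu|], which lies in the standard cylinder of radius [`|mu|].
    Non-squeezing gives [1 <= `|mu|], hence [`|det g| <= 1]
    ([sl_nonsqueezing_det_le1]).  Applying this to both pairs
    [(Psi, Psi^-1)] and [(Psi^-1, Psi)] bounds both determinants by 1; since
    their product is 1, both have modulus exactly 1. *)

Definition colmx (R : realType) (n : nat) (w : 'I_n -> 'cV[R[i]]_n)
  : 'M[R[i]]_n := \matrix_(j, k) w k j 0.

Definition linmx (R : realType) (n : nat) (f : 'End('cV[R[i]]_n))
  : 'M[R[i]]_n := colmx R n (fun k => f (delta_mx k 0)).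

Lemma linmxE (R : realType) (n : nat) (f : 'End('cV[R[i]]_n)) v :
  f v = linmx R n f *m v.
Proof.
apply/colP => j; rewrite mxE.
have {1}-> : v = \sum_k v k 0 *: delta_mx k 0.
  by rewrite {1}[v]matrix_sum_delta; apply: eq_bigr => k _; rewrite big_ord1.
rewrite linear_sum summxE; apply: eq_bigr => k _.
by rewrite linearZ !mxE mulrC.
Qed.

Lemma linmx_cancel (R : realType) (n : nat) (f g : 'End('cV[R[i]]_n)) :
  cancel g f -> linmx R n f *m linmx R n g = 1%:M.
Proof.
move=> gK; apply/matrixP => j k.
have /(congr1 (fun v : 'cV_n => v j 0)) := gK (delta_mx k 0).
by rewrite 2!linmxE mulmxA -colE !mxE andbT.
Qed.

Lemma Omega_det (R : realType) (n : nat) (w : 'I_n -> 'cV[R[i]]_n) :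
  Omega w = \det (colmx R n w).
Proof.
rewrite /Omega /wedge; congr (\det _); apply/matrixP => j k.
by rewrite !mxE /dz /xcoord /ycoord; case: (w k j 0).
Qed.

Lemma pullback_mulmx_Omega (R : realType) (n : nat) (M : 'M[R[i]]_n)
    (w : 'I_n -> 'cV[R[i]]_n) :
  pullback (mulmx M) Omega w = \det M * Omega w.
Proof.
rewrite /pullback !Omega_det -det_mulmx; congr (\det _); apply/matrixP => j k.
by rewrite !mxE; apply: eq_bigr => l _; rewrite !mxE.
Qed.

Lemma pullback_Omega (R : realType) (n : nat) (f : 'End('cV[R[i]]_n))
    (w : 'I_n -> 'cV[R[i]]_n) :
  pullback f Omega w = \det (linmx R n f) * Omega w.
Proof.
rewrite -pullback_mulmx_Omega /pullback !Omega_det; congr (\det _).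
by apply/matrixP => j k; rewrite !mxE linmxE mxE.
Qed.

Lemma enormZ (R : realType) (n : nat) (mu : R[i]) (v : 'cV[R[i]]_n) :
  enorm (mu *: v) = complex.Re `|mu| * enorm v.
Proof.
rewrite normc_def /= /enorm -sqrtrM ?addr_ge0 ?sqr_ge0 //; congr Num.sqrt.
rewrite /edot mulr_sumr; apply: eq_bigr => k _.
rewrite /xcoord /ycoord !mxE; case: mu => a b; case: (v k 0) => c d /=.
by ring.
Qed.

Lemma enorm_projL_le (R : realType) (n : nat) (v : 'cV[R[i]]_n) :
  enorm (projL v) <= enorm v.
Proof.
apply: ler_wsqrtr; apply: ler_sum => k _.
rewrite /xcoord /ycoord !mxE /=.
by rewrite mulr0 addr0 lerDl -expr2 sqr_ge0.
Qed.

Lemma sl_cylinder_cylL (R : realType) (n : nat) (rho : R) :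
  sl_cylinder rho (@cylL R n rho).
Proof.
by exists id; split=> //; rewrite image_id.
Qed.

(** With [mu ^+ n * det g = 1], the ball [mu *: g (ball0 1)] is special
    Lagrangian of radius 1, while its image under [f] is the round ball of
    radius [`|mu|]. *)
Lemma sl_nonsqueezing_det_le1 (R : realType) (n : nat)
    (f g : 'End('cV[R[i]]_n)) :
  cancel g f -> sl_nonsqueezing f -> `|\det (linmx R n g)| <= 1.
Proof.
move=> gK ns.
have detg0 : \det (linmx R n g) != 0.
  have /mulmx1_unit[_] := linmx_cancel R n f g gK.
  by rewrite unitmxE unitfE.
case: (posnP n) => [n0|n_gt0].
  (* The root mu below needs a positive degree; a 0 x 0 determinant is 1. *)
  by move: f g gK ns detg0; rewrite n0 => *; rewrite det_mx00 normr1.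
set d := \det _ in detg0 *.
pose mu := n.-root d^-1.
have muX : mu ^+ n * d = 1 by rewrite rootCK // mulVf.
have mu0 : mu != 0.
  apply/eqP => mu0; move/eqP: muX.
  by rewrite mu0 expr0n gtn_eqF // mul0r eq_sym oner_eq0.
have rhoE : `|mu| = (complex.Re `|mu|)%:C by rewrite normc_def.
have rho_gt0 : 0 < complex.Re `|mu|.
  by rewrite -ltcR -rhoE normr_gt0.
have ball : sl_ball 1 (mulmx (mu *: linmx R n g) @` @ball0 R n 1)%classic.
  exists (mulmx (mu *: linmx R n g)); split=> //.
  - by move=> a u v; rewrite mulmxDr -scalemxAr.
  - by move=> w; rewrite pullback_mulmx_Omega detZ muX mul1r.
have /(ns 1 _ _ _ ltr01 rho_gt0 ball) := sl_cylinder_cylL R n (complex.Re `|mu|).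
have sub : (f @` (mulmx (mu *: linmx R n g) @` @ball0 R n 1)
            `<=` @cylL R n (complex.Re `|mu|))%classic.
  move=> _ [_ [v v1 <-] <-].
  rewrite -scalemxAl -linmxE linearZ /= gK /cylL /=.
  rewrite lerXn2r ?nnegrE ?sqrtr_ge0 ?(ltW rho_gt0) //.
  apply: le_trans (enorm_projL_le R n _) _.
  by rewrite enormZ ler_piMr // ltW.
move=> /(_ sub); rewrite -lecR -rhoE => mu_ge1.
have := congr1 (fun z : R[i] => `|z|) muX; rewrite normrM normrX normr1 => <-.
by rewrite ler_peMl // exprn_ege1.
Qed.

(** The phase is [acos x] or [- acos x], according to the sign of the imaginary
    part. *)
Lemma unit_complex_phase (R : realType) (c : R[i]) :
  `|c| = 1 -> exists theta : R, c = cos theta +i* sin theta.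
Proof.
case: c => x y; rewrite normc_def /= => -[] /(congr1 (fun z => z ^+ 2)).
rewrite sqr_sqrtr ?addr_ge0 ?sqr_ge0 // expr1n => xy1.
have x11 : -1 <= x <= 1.
  by rewrite -ler_norml -(@ler_pXn2r _ 2) ?nnegrE // real_normK ?num_real //
    expr1n -xy1 lerDl sqr_ge0.
have sinE : sin (acos x) = `|y|.
  by rewrite sin_acos // -xy1 addrC addKr sqrtr_sqr.
have [y0|y0] := leP 0 y.
- by exists (acos x); rewrite acosK // sinE ger0_norm.
- by exists (- acos x); rewrite cosN sinN acosK // sinE ltr0_norm // opprK.
Qed.

Theorem theorem5p10 (R : realType) (n : nat) (Psi : 'End('cV[R[i]]_n)) :
  lker Psi = 0%VS ->
  sl_nonsqueezing Psi ->
  sl_nonsqueezing (Psi^-1)%VF ->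
  exists theta : R, forall w : 'I_n -> 'cV[R[i]]_n,
    pullback Psi Omega w = (cos theta +i* sin theta) * Omega w.
Proof.
move=> /eqP kerPsi nsPsi nsInv.
have PsiK : cancel Psi (Psi^-1)%VF by apply: lker0_lfunK.
have PsiVK : cancel (Psi^-1)%VF Psi.
  by move=> v; rewrite -[LHS]comp_lfunE lker0_compfV // id_lfunE.
have le1 := sl_nonsqueezing_det_le1 R n _ _ PsiK nsInv.
have leV1 := sl_nonsqueezing_det_le1 R n _ _ PsiVK nsPsi.
have det1 : `|\det (linmx R n Psi)| * `|\det (linmx R n (Psi^-1)%VF)| = 1.
  by rewrite -normrM -det_mulmx linmx_cancel // det1 normr1.
have [|theta thetaE] := unit_complex_phase R (\det (linmx R n Psi)).
  by apply/le_anti; rewrite le1 -det1 ler_piMr.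
by exists theta => w; rewrite pullback_Omega thetaE.
Qed.
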